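(* Let $\mathbb F$ be either $\mathbb R$ or $\mathbb C$. Then in every dimension $n\ge7$ there is an infinite (in fact uncountable) number of isomorphy classes of admissible algebras over $\mathbb F$ of dimension $n$ and nil-index $3$.
   Context: Algebras are associative $\mathbb F$-algebras. For an algebra $\mathcal N$ put $\mathcal N^1=\mathcal N$ and let $\mathcal N^{k+1}$ be the linear span of $\mathcal N\mathcal N^k$; $\mathcal N$ is nilpotent if $\mathcal N^{k+1}=0$ for some $k\ge0$, and the minimal such $k$ is the nil-index. An admissible algebra is a commutative nilpotent algebra $\mathcal N$ of finite dimension over $\mathbb F$ whose annihilator $\{x\in\mathcal N:x\mathcal N=0\}$ has dimension $1$. *)

(* Defs.v *)
From HB Require Import structures.
From mathcomp Require Import all_boot all_order all_algebra.
From mathcomp Require Import sesquilinear.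
From mathcomp Require Import boolp classical_sets functions cardinality reals.
From mathcomp Require Import complex.

Set Implicit Arguments.
Unset Strict Implicit.
Unset Printing Implicit Defensive.

Import GRing.Theory.

Local Open Scope classical_set_scope.
Local Open Scope ring_scope.

(* Finite-dimensional associative algebras, without a unit: the algebra
   structures of MathComp ([lalgType], [falgType]) are all unital, hence never
   nilpotent. *)
Record assocAlgebra (F : fieldType) := AssocAlgebra {
  alg_carrier :> vectType F;
  amul : {bilinear alg_carrier -> alg_carrier -> alg_carrier};
  amulA : associative amul
}.

Arguments amul {F a}.

Section AssocAlgebra.
Variable F : fieldType.
Implicit Types A B : assocAlgebra F.

Definition isomorphic A B : Prop :=
  exists f : {linear A -> B},
    bijective f /\ forall x y : A, f (amul x y) = amul (f x) (f y).

(* [<<s>>] spans a finite sequence; an arbitrary set is spanned by its finite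
   subsequences. *)
Definition lin_span (V : vectType F) (S : set V) : set V :=
  [set v | exists s : seq V, (forall w, w \in s -> S w) /\ v \in <<s>>%VS].

(* The exponent is shifted: [apowS A k] is the power A^(k+1), so that
   A^1 = A and A^(k+1) is the span of A A^k. *)
Fixpoint apowS A (k : nat) : set A :=
  if k is j.+1 then
    lin_span [set z | exists x y : A, apowS j y /\ z = amul x y]
  else setT.

Arguments apowS : clear implicits.

Definition nilpotent_alg A : Prop := exists k, apowS A k = [set 0].

Definition has_nil_index A (k : nat) : Prop :=
  apowS A k = [set 0] /\ forall j, apowS A j = [set 0] -> (k <= j)%N.

Definition annihilator A : set A := [set x | forall y : A, amul x y = 0].

Arguments annihilator : clear implicits.

Definition set_has_dim (V : vectType F) (S : set V) (d : nat) : Prop :=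
  exists U : {vspace V}, S = [set` U] /\ \dim U = d.

Definition admissible A : Prop :=
  [/\ commutative (@amul F A), nilpotent_alg A & set_has_dim (annihilator A) 1].

Definition admissible_dim_nil_index (n k : nat) A : Prop :=
  [/\ admissible A, \dim {:A} = n & has_nil_index A k].

End AssocAlgebra.

(* For an equivalence relation [E] on [T]: the objects satisfying [P] fall into
   at most countably many [E]-classes.  The left-hand implication makes [f]
   injective on classes, the right-hand one makes it well defined on them.
   MathComp-Analysis' [countable] cannot be applied to the set of classes, since
   the universe of [set] lies strictly below that of [assocAlgebra F]. *)
Definition countably_many_classes (T : Type) (P : T -> Prop)
    (E : T -> T -> Prop) : Prop :=
  exists f : T -> nat,
    forall x y : T, P x -> P y -> (f x = f y <-> E x y).

Definition uncountably_many_admissible (F : fieldType) (n k : nat) : Prop :=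
  ~ countably_many_classes
      (@admissible_dim_nil_index F n k) (@isomorphic F).

(* Main.v *)
From HB Require Import structures.
Require Import Defs.
From mathcomp Require Import all_boot all_order all_algebra.
From mathcomp Require Import sesquilinear ring lra.
From mathcomp Require Import boolp classical_sets functions cardinality.
From mathcomp Require Import set_interval constructive_ereal lebesgue_measure.
From mathcomp Require Import reals complex.

Set Implicit Arguments.
Unset Strict Implicit.
Unset Printing Implicit Defensive.

Import Order.TTheory GRing.Theory Num.Theory.

Local Open Scope ring_scope.

(* A cubic form on V = F^3 turns V + V^* + F^r + F into an admissible algebra of
   dimension 7 + r and nil-index 3: the product of two vectors of V is the
   contraction of the cubic with them, and V with V^*, and F^r with itself, are
   paired into the last summand.  An isomorphism of two such algebras makes the
   cubics equivalent up to a scalar.  On the Hesse pencil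
   f_m = x^3 + y^3 + z^3 + 6 m x y z the Hessian covariant H stays in the pencil,
   and H(H(f_m)) = alpha(m) f_m + beta(m) H(f_m), where alpha and beta are, up to
   constants, S^2 and T for the Aronhold invariants S and T.  Comparing the
   coefficients shows that alpha^3 / beta^4 depends only on the equivalence class
   of f_m; it is injective on 0 < m < 1/10. *)

(** * Ternary cubics of the Hesse pencil and their Hessians *)

(* For [i != j], the index [- (i + j)] modulo 3 is the third one; for [i = j] it
   is [i]. *)
Definition hesse_mx (F : fieldType) (v : F * F) (y : 'rV[F]_3) : 'M[F]_3 :=
  \matrix_(i, j) ((if i == j then v.1 else v.2) * y 0 (- (i + j))).

Definition hesse_cubic (F : fieldType) (v : F * F) (y : 'rV[F]_3) : F :=
  v.1 * (y 0 0 ^+ 3 + y 0 1 ^+ 3 + y 0 2 ^+ 3)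
  + 6 * v.2 * (y 0 0 * y 0 1 * y 0 2).

(** The polar form of [hesse_cubic v]: [hesse_mx v y] is one sixth of the Hessian matrix at [y]. *)
Definition hesse_tri (F : fieldType) (v : F * F) (x y z : 'rV[F]_3) : F :=
  (x *m hesse_mx v y *m z^T) 0 0.

Lemma ord3_lift :
  (lift ord0 (ord0 : 'I_2) = 1 :> 'I_3)
  * (lift ord0 (lift ord0 (ord0 : 'I_1)) = 2 :> 'I_3).
Proof. by split; apply/val_inj. Qed.

Lemma ord3_opp_add :
  (((- (ord0 + ord0) = 0 :> 'I_3) * (- (ord0 + 1) = 2 :> 'I_3) * (- (ord0 + 2) = 1 :> 'I_3))
  * ((- (1 + ord0) = 2 :> 'I_3) * (- (1 + 1) = 1 :> 'I_3) * (- (1 + 2) = 0 :> 'I_3))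
  * ((- (2 + ord0) = 1 :> 'I_3) * (- (2 + 1) = 0 :> 'I_3) * (- (2 + 2) = 2 :> 'I_3)))%type.
Proof. by do !split; apply/val_inj. Qed.

Lemma hesse_triE (F : fieldType) (v : F * F) (x y z : 'rV[F]_3) :
  hesse_tri v x y z =
  v.1 * (x 0 0 * y 0 0 * z 0 0 + x 0 1 * y 0 1 * z 0 1 + x 0 2 * y 0 2 * z 0 2)
  + v.2 * (x 0 0 * y 0 1 * z 0 2 + x 0 0 * y 0 2 * z 0 1 + x 0 1 * y 0 0 * z 0 2
         + x 0 1 * y 0 2 * z 0 0 + x 0 2 * y 0 0 * z 0 1 + x 0 2 * y 0 1 * z 0 0).
Proof.
rewrite /hesse_tri !mxE !big_ord_recl big_ord0 !mxE !big_ord_recl !big_ord0 !mxE.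
rewrite /= !ord3_lift !ord3_opp_add.
ring.
Qed.

Lemma det_mx3 (F : fieldType) (A : 'M[F]_3) :
  \det A = A 0 0 * A 1 1 * A 2 2 + A 0 1 * A 1 2 * A 2 0 + A 0 2 * A 1 0 * A 2 1
         - A 0 0 * A 1 2 * A 2 1 - A 0 1 * A 1 0 * A 2 2 - A 0 2 * A 1 1 * A 2 0.
Proof.
(* Indexing by [nat] lets the lifted ordinals of the cofactors compute to numerals, so that [ring]
   identifies equal entries. *)
pose a (i j : nat) := A (inord i) (inord j).
have aE i j : A i j = a i j by rewrite /a !inord_val.
rewrite (expand_det_row _ 0) !big_ord_recl big_ord0 /cofactor.
rewrite !(expand_det_row _ 0) !big_ord_recl !big_ord0 /cofactor !det_mx11 !mxE.
rewrite !aE /= /bump /=.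
ring.
Qed.

(** Polarization: once 6 is invertible, a transformation rule for the cubic passes to its trilinear
    form. *)
Lemma hesse_tri_cubic (F : fieldType) (v : F * F) (x y z : 'rV[F]_3) :
  6 * hesse_tri v x y z =
  hesse_cubic v (x + y + z) - hesse_cubic v (x + y) - hesse_cubic v (x + z)
  - hesse_cubic v (y + z) + hesse_cubic v x + hesse_cubic v y + hesse_cubic v z.
Proof. rewrite hesse_triE /hesse_cubic !mxE. ring. Qed.

Lemma hesse_cubic_tri (F : fieldType) (v : F * F) (x : 'rV[F]_3) :
  hesse_cubic v x = hesse_tri v x x x.
Proof. rewrite hesse_triE /hesse_cubic. ring. Qed.

(** Parameters of the Hessian determinant up to a constant; scaling [\det (hesse_mx v y)] by 6
    avoids a division in the second one. *)
Definition hesse_hessian (F : fieldType) (v : F * F) : F * F :=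
  (- 6 * v.1 * v.2 ^+ 2, v.1 ^+ 3 + 2 * v.2 ^+ 3).

Lemma det_hesse_mx (F : fieldType) (v : F * F) (y : 'rV[F]_3) :
  6 * \det (hesse_mx v y) = hesse_cubic (hesse_hessian v) y.
Proof.
rewrite det_mx3 !mxE /= !ord3_opp_add /hesse_cubic /=. ring.
Qed.

Lemma bilinear_form_inj (F : fieldType) (n : nat) (A B : 'M[F]_n) :
  (forall x z : 'rV_n, (x *m A *m z^T) 0 0 = (x *m B *m z^T) 0 0) -> A = B.
Proof.
move=> AB; apply/matrixP => i j.
have coef C : ((delta_mx 0 i : 'rV[F]_n) *m C *m (delta_mx 0 j : 'rV[F]_n)^T) 0 0 = C i j.
  by rewrite trmx_delta -mulmxA -colE -rowE !mxE.
by rewrite -!coef AB.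
Qed.

(** By polarization [hesse_mx] transforms as a bilinear form, [g M_v(y g) g^T = c M_w(y)]; then take
    determinants. *)
Lemma hesse_hessian_covariant (F : fieldType) (v w : F * F) (g : 'M[F]_3) (c : F) :
  6 != 0 :> F ->
  (forall y, hesse_cubic v (y *m g) = c * hesse_cubic w y) ->
  forall y, \det g ^+ 2 * hesse_cubic (hesse_hessian v) (y *m g)
            = c ^+ 3 * hesse_cubic (hesse_hessian w) y.
Proof.
move=> nz6 vw y.
have tri x z : hesse_tri v (x *m g) (y *m g) (z *m g) = c * hesse_tri w x y z.
  apply: (mulfI nz6); rewrite mulrCA !hesse_tri_cubic -!mulmxDl !vw; ring.
have -> : hesse_cubic (hesse_hessian w) y = 6 * \det (hesse_mx w y)
  by rewrite det_hesse_mx.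
have : g *m hesse_mx v (y *m g) *m g^T = c *: hesse_mx w y.
  apply: bilinear_form_inj => x z.
  have := tri x z; rewrite /hesse_tri trmx_mul !mulmxA => ->.
  by rewrite -scalemxAr -scalemxAl [RHS]mxE.
move=> /(congr1 determinant); rewrite detZ !det_mulmx det_tr -det_hesse_mx => E.
transitivity (6 * (\det g * \det (hesse_mx v (y *m g)) * \det g)); first by ring.
by rewrite E; ring.
Qed.

(** * The invariant of a cubic in the pencil *)

(** With [S = m - m^4] and [T = 1 - 20 m^3 - 8 m^6], these are [48 S^2] and [2 T]. *)
Definition hesse_alpha (F : fieldType) (m : F) : F := 48 * m ^+ 2 * (1 - m ^+ 3) ^+ 2.
Definition hesse_beta (F : fieldType) (m : F) : F :=
  2 * (1 - 20 * m ^+ 3 - 8 * m ^+ 6).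

Lemma hesse_hessian2 (F : fieldType) (m : F) (y : 'rV[F]_3) :
  hesse_cubic (hesse_hessian (hesse_hessian (1, m))) y =
  hesse_alpha m * hesse_cubic (1, m) y
  + hesse_beta m * hesse_cubic (hesse_hessian (1, m)) y.
Proof.
rewrite /hesse_cubic /hesse_hessian /hesse_alpha /hesse_beta /=. ring.
Qed.

(** [1 + 8 m^3] is the determinant of the parameter pairs of [f_m] and its Hessian. The points
    (1,0,0) and (1,1,1) suffice as tests. *)
Lemma hesse_cubic_hessian_free (F : fieldType) (m a b : F) :
  6 != 0 :> F -> 1 + 8 * m ^+ 3 != 0 ->
  (forall y, a * hesse_cubic (1, m) y + b * hesse_cubic (hesse_hessian (1, m)) y = 0) ->
  a = 0 /\ b = 0.
Proof.
move=> nz6 nzD ab0.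
have e0 : a - 6 * m ^+ 2 * b = 0.
  rewrite -[RHS](ab0 (delta_mx 0 0)) /hesse_cubic /hesse_hessian !mxE /=; ring.
have e1 : (3 + 6 * m) * a + (6 + 12 * m ^+ 3 - 18 * m ^+ 2) * b = 0.
  rewrite -[RHS](ab0 (const_mx 1)) /hesse_cubic /hesse_hessian !mxE /=; ring.
have b0 : b = 0.
  (* [e1] minus [3 + 6 m] times [e0] reads [6 (1 + 8 m^3) b = 0]. *)
  apply/eqP; rewrite -(mulrI_eq0 _ (mulfI nz6)) -(mulrI_eq0 _ (mulfI nzD)).
  rewrite -[X in _ == X]e1 -[X in _ == X]subr0 -[X in _ - X](mulr0 (3 + 6 * m)).
  by rewrite -[X in _ - _ * X]e0; apply/eqP; ring.
by split=> //; rewrite -e0 b0 mulr0 subr0.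
Qed.

(** With [d = \det g] and [k = c^3 / d^2], comparing second Hessians gives
    [d^2 c alpha(t) = k^3 alpha(s)] and [d^2 beta(t) = k^2 beta(s)]. The exponents 3 and 4 turn both
    factors into [k^8 / d^8]. *)
Lemma hesse_equiv_invariant (F : fieldType) (s t : F) (g : 'M[F]_3) (c : F) :
  6 != 0 :> F -> c != 0 -> 1 + 8 * s ^+ 3 != 0 ->
  (forall y, hesse_cubic (1, t) (y *m g) = c * hesse_cubic (1, s) y) ->
  hesse_alpha t ^+ 3 * hesse_beta s ^+ 4 = hesse_alpha s ^+ 3 * hesse_beta t ^+ 4.
Proof.
move=> nz6 nzc nzD ts.
have ts1 := hesse_hessian_covariant nz6 ts.
set d := \det g in ts1.
(* A singular [g] would make [c^3] times the Hessian of [f_s] vanish. *)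
have nzd : d != 0.
  apply: contra_neq nzc => d0.
  have [] // := @hesse_cubic_hessian_free F s 0 (c ^+ 3) nz6 nzD.
    by move=> y; rewrite mul0r add0r -ts1 d0 expr0n mul0r.
  by move=> _ /eqP; rewrite expf_eq0 => /eqP.
pose k := c ^+ 3 / d ^+ 2.
have kd : c ^+ 3 = k * d ^+ 2 by rewrite /k mulfVK // expf_neq0.
have nzk : k != 0 by rewrite mulf_neq0 ?invr_eq0 ?expf_neq0.
have {}ts1 y : hesse_cubic (hesse_hessian (1, t)) (y *m g)
             = k * hesse_cubic (hesse_hessian (1, s)) y.
  by apply: (mulfI (expf_neq0 2 nzd)); rewrite ts1 kd; ring.
have ts2 := hesse_hessian_covariant nz6 ts1; rewrite -/d in ts2.
have [] // := @hesse_cubic_hessian_free F s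
  (d ^+ 2 * c * hesse_alpha t - k ^+ 3 * hesse_alpha s)
  (d ^+ 2 * k * hesse_beta t - k ^+ 3 * hesse_beta s) nz6 nzD.
  move=> y; have := ts2 y; rewrite !hesse_hessian2 ts ts1 => /eqP.
  by rewrite -subr_eq0 => /eqP E; rewrite -[RHS]E; ring.
move=> /eqP; rewrite subr_eq0 => /eqP Ea /eqP; rewrite subr_eq0 => /eqP Eb.
have {}Eb : d ^+ 2 * hesse_beta t = k ^+ 2 * hesse_beta s.
  by apply: (mulfI nzk); rewrite mulrCA mulrA Eb; ring.
have {}Ea : d ^+ 8 * hesse_alpha t ^+ 3 = k ^+ 8 * hesse_alpha s ^+ 3.
  apply: (mulfI nzk).
  transitivity ((k * d ^+ 2) * d ^+ 6 * hesse_alpha t ^+ 3); first by ring.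
  rewrite -kd.
  transitivity ((d ^+ 2 * c * hesse_alpha t) ^+ 3); first by ring.
  by rewrite Ea; ring.
apply: (mulfI (expf_neq0 8 nzd)).
rewrite mulrA Ea.
transitivity (hesse_alpha s ^+ 3 * (k ^+ 2 * hesse_beta s) ^+ 4); first by ring.
by rewrite -Eb; ring.
Qed.

(** On this interval [alpha] is nonnegative and increasing while [beta] is positive and decreasing,
    so [alpha^3 / beta^4] increases. *)
Lemma hesse_invariant_inj (R : realType) (s t : R) :
  0 < s < 1 / 10 -> 0 < t < 1 / 10 ->
  hesse_alpha t ^+ 3 * hesse_beta s ^+ 4 = hesse_alpha s ^+ 3 * hesse_beta t ^+ 4 ->
  s = t.
Proof.
wlog st : s t / s < t => [IH|] hs ht E.
  case: (ltgtP s t) => // st; first exact: IH.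
  by apply/esym/IH.
suff : hesse_alpha s ^+ 3 * hesse_beta t ^+ 4 < hesse_alpha t ^+ 3 * hesse_beta s ^+ 4.
  by rewrite E ltxx.
have [/andP[s0 s1] /andP[t0 t1]] := (hs, ht).
have s30 : 0 < s ^+ 3 by rewrite exprn_gt0.
have st3 : s ^+ 3 < t ^+ 3 by rewrite ltrXn2r // ?ltW.
have t31 : t ^+ 3 < (1 / 10) ^+ 3 by rewrite ltrXn2r // ?ltW.
have st6 : s ^+ 6 < t ^+ 6 by rewrite ltrXn2r // ?ltW.
have t61 : t ^+ 6 < (1 / 10) ^+ 6 by rewrite ltrXn2r // ?ltW.
have b0 : 0 < hesse_beta t by rewrite /hesse_beta; lra.
have bts : hesse_beta t < hesse_beta s by rewrite /hesse_beta; lra.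
have aE (m : R) : hesse_alpha m = 48 * (m * (1 - m ^+ 3)) ^+ 2.
  by rewrite /hesse_alpha; ring.
have q0 : 0 < s * (1 - s ^+ 3) by rewrite mulr_gt0 //; lra.
have qst : s * (1 - s ^+ 3) < t * (1 - t ^+ 3).
  rewrite -subr_gt0.
  have -> : t * (1 - t ^+ 3) - s * (1 - s ^+ 3) =
      (t - s) * (1 - (t + s) * (t ^+ 2 + s ^+ 2)) by ring.
  by rewrite mulr_gt0 ?subr_gt0 //; nra.
have a0 : 0 <= hesse_alpha s by rewrite aE mulr_ge0 ?sqr_ge0.
have ast : hesse_alpha s < hesse_alpha t.
  by rewrite !aE ltr_pM2l // ltrXn2r // ltW // (lt_trans q0).
have b1 := ltW b0.
apply: ltr_pM; [exact: exprn_ge0 | exact: exprn_ge0 | by rewrite ltrXn2r | by rewrite ltrXn2r].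
Qed.

(** * Linear spans, dot products and contractions *)

Lemma lin_span_ind (F : fieldType) (V : vectType F) (S : set V) (P : V -> Prop) :
  P 0 -> (forall a u v, P u -> P v -> P (a *: u + v)) ->
  (forall w, S w -> P w) -> forall w, lin_span S w -> P w.
Proof.
move=> P0 PD SP w [s [sS]]; rewrite -[s]/(val (in_tuple s)) => /coord_span ->.
apply: big_ind => // [u v Pu Pv|i _]; first by rewrite -[u]scale1r; apply: PD.
by rewrite -[X in P X]addr0; apply: PD => //; apply/SP/sS; rewrite mem_nth.
Qed.

Lemma lin_span_incl (F : fieldType) (V : vectType F) (S : set V) (w : V) :
  S w -> lin_span S w.
Proof.
move=> Sw; exists [:: w]; split; last by rewrite memv_span ?mem_head.
by move=> u; rewrite inE => /eqP ->.
Qed.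

Lemma lin_span0 (F : fieldType) (V : vectType F) (S : set V) : lin_span S 0.
Proof. by exists [::]; split=> //; rewrite mem0v. Qed.

Lemma row_dotC (F : fieldType) (n : nat) (x y : 'rV[F]_n) : x *m y^T = y *m x^T.
Proof.
apply/matrixP => i j; rewrite !ord1 !mxE.
by apply: eq_bigr => k _; rewrite !mxE mulrC.
Qed.

Lemma row_dot_delta (F : fieldType) (n : nat) (x : 'rV[F]_n) i :
  (x *m (delta_mx 0 i : 'rV_n)^T) 0 0 = x 0 i.
Proof. by rewrite trmx_delta -colE mxE. Qed.

Lemma row_dot_inj (F : fieldType) (n : nat) (x : 'rV[F]_n) :
  (forall y : 'rV_n, x *m y^T = 0) -> x = 0.
Proof. by move=> x0; apply/rowP => i; rewrite -row_dot_delta x0 !mxE. Qed.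

Lemma hesse_mx0 (F : fieldType) (v : F * F) : hesse_mx v 0 = 0.
Proof. by apply/matrixP => i j; rewrite !mxE mulr0. Qed.

Lemma hesse_mulC (F : fieldType) (v : F * F) (x y : 'rV[F]_3) :
  x *m hesse_mx v y = y *m hesse_mx v x.
Proof.
apply/rowP => k; rewrite -[LHS]row_dot_delta -[RHS]row_dot_delta.
by rewrite -[LHS]/(hesse_tri v x y _) -[RHS]/(hesse_tri v y x _) !hesse_triE; ring.
Qed.

(** Total symmetry of the trilinear form; associativity of the algebra rests on it. *)
Lemma hesse_mulA (F : fieldType) (v : F * F) (x y z : 'rV[F]_3) :
  x *m (y *m hesse_mx v z)^T = x *m hesse_mx v y *m z^T.
Proof.
apply/matrixP => i j; rewrite !ord1 (row_dotC x).
by rewrite -[LHS]/(hesse_tri v y z x) -[RHS]/(hesse_tri v x y z) !hesse_triE; ring.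
Qed.

(** * The algebra of a Hesse cubic *)

(** The summands V, V^*, F^r and F; the dot product identifies V^* with rows, and F is ['M_1] so
    that [x *m y^T] lands in it. *)
Definition hesse_space (F : fieldType) (r : nat) : vectType F :=
  ('rV[F]_3 * 'rV[F]_3 * 'rV[F]_r * 'M[F]_1)%type.

Definition hesse_mul (F : fieldType) (m : F) (r : nat) (u v : hesse_space F r) :
    hesse_space F r :=
  (0, u.1.1.1 *m hesse_mx (1, m) v.1.1.1, 0,
   u.1.1.1 *m v.1.1.2^T + u.1.1.2 *m v.1.1.1^T + u.1.2 *m v.1.2^T).

Lemma hesse_mul_comm (F : fieldType) (m : F) r : commutative (@hesse_mul F m r).
Proof.
move=> u v; rewrite /hesse_mul hesse_mulC; congr (_, _).
by rewrite (row_dotC u.1.2) (row_dotC u.1.1.1) (row_dotC u.1.1.2) [X in X + _]addrC.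
Qed.

Lemma hesse_mul_assoc (F : fieldType) (m : F) r : associative (@hesse_mul F m r).
Proof.
move=> u v w; rewrite /hesse_mul /= hesse_mx0.
by rewrite !(mul0mx, mulmx0, trmx0, addr0, add0r) hesse_mulA.
Qed.

Lemma hesse_mul_bilinear (F : fieldType) (m : F) r :
  bilinear_for *:%R *:%R (@hesse_mul F m r).
Proof.
have linl u : linear (fun v => hesse_mul m v u : hesse_space F r).
  move=> a v w; rewrite /hesse_mul /= !mulmxDl -!scalemxAl.
  congr (_, _, _, _) => /=; rewrite ?scaler0 ?addr0 //.
  by rewrite !scalerDr [RHS]addrACA [X in _ = X + _]addrACA.
split=> // u a v w; rewrite !(hesse_mul_comm m u); exact: linl.
Qed.

HB.instance Definition _ (F : fieldType) (m : F) r :=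
  bilinear_isBilinear.Build F (hesse_space F r) (hesse_space F r) (hesse_space F r)
    *:%R *:%R (@hesse_mul F m r) (hesse_mul_bilinear m r).

Definition hesse_algebra (F : fieldType) (m : F) (r : nat) : assocAlgebra F :=
  @AssocAlgebra F (hesse_space F r) (@hesse_mul F m r) (@hesse_mul_assoc F m r).

Lemma hesse_mulE (F : fieldType) (m : F) r (u v : hesse_algebra m r) :
  amul u v = (0, u.1.1.1 *m hesse_mx (1, m) v.1.1.1, 0,
   u.1.1.1 *m v.1.1.2^T + u.1.1.2 *m v.1.1.1^T + u.1.2 *m v.1.2^T).
Proof. by []. Qed.

Lemma dim_hesse_algebra (F : fieldType) (m : F) r :
  \dim {:hesse_algebra m r} = (7 + r)%N.
Proof.
rewrite dimvf -[dim _]/(1 * 3 + 1 * 3 + 1 * r + 1 * 1)%N !mul1n [LHS]addnC.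
by [].
Qed.

Definition hesse_top (F : fieldType) (m : F) r : hesse_algebra m r :=
  (0, 0, 0, 1%:M).

Definition hesse_gen (F : fieldType) (m : F) r (x : 'rV[F]_3) : hesse_algebra m r :=
  (x, 0, 0, 0).

Lemma hesse_top_neq0 (F : fieldType) (m : F) r : hesse_top m r != 0.
Proof.
apply/eqP => /(congr1 (fun u : hesse_space F r => u.2 0 0)) /=.
by rewrite !mxE => /eqP; rewrite oner_eq0.
Qed.

(** Triple products recover the cubic from the multiplication. *)
Lemma hesse_mul3 (F : fieldType) (m : F) r (u v w : hesse_algebra m r) :
  amul u (amul v w) = hesse_tri (1, m) u.1.1.1 v.1.1.1 w.1.1.1 *: hesse_top m r.
Proof.
rewrite !hesse_mulE /= hesse_mx0 !trmx0 !mulmx0 !addr0 hesse_mulA.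
congr (_, _, _, _) => /=; rewrite ?scaler0 //.
by rewrite scale_scalar_mx mulr1 [LHS]mx11_scalar.
Qed.

(** [apowS] being shifted, this bounds A^2 by V^* + F; next, A^3 falls into the line of [hesse_top],
    and A^4 vanishes. *)
Lemma hesse_pow1 (F : fieldType) (m : F) r (u : hesse_algebra m r) :
  @apowS F (hesse_algebra m r) 1 u -> u.1.1.1 = 0 /\ u.1.2 = 0.
Proof.
move: u; apply: lin_span_ind => // [a u v [u1 u2] [v1 v2]|w [x [y [_ ->]]]] //.
by split; rewrite /= ?u1 ?u2 ?v1 ?v2 scaler0 addr0.
Qed.

Lemma hesse_pow2 (F : fieldType) (m : F) r (u : hesse_algebra m r) :
  @apowS F (hesse_algebra m r) 2 u -> exists a, u = a *: hesse_top m r.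
Proof.
move: u; apply: lin_span_ind => [|a u v [b ->] [c ->]|w [x [y [Ay ->]]]].
- by exists 0; rewrite scale0r.
- by exists (a * b + c); rewrite scalerDl scalerA.
- have [y1 y2] := hesse_pow1 Ay.
  exists ((x.1.1.1 *m y.1.1.2^T) 0 0).
  rewrite hesse_mulE y1 y2 hesse_mx0 !trmx0 !mulmx0 !addr0.
  congr (_, _, _, _) => /=; rewrite ?scaler0 //.
  by rewrite scale_scalar_mx mulr1 [LHS]mx11_scalar.
Qed.

Lemma hesse_mul_top (F : fieldType) (m : F) r (u : hesse_algebra m r) a :
  amul u (a *: hesse_top m r) = 0.
Proof.
by rewrite hesse_mulE /= !scaler0 hesse_mx0 !trmx0 !mulmx0 !addr0.
Qed.

Lemma hesse_pow3 (F : fieldType) (m : F) r :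
  @apowS F (hesse_algebra m r) 3 = [set 0]%classic.
Proof.
apply/seteqP; split=> [u|u ->]; last exact: lin_span0.
move: u; apply: lin_span_ind => [//|a u v -> ->|w [x [y [Ay ->]]]].
  by rewrite scaler0 addr0.
by have [a ->] := hesse_pow2 Ay; exact: hesse_mul_top.
Qed.

Lemma hesse_nil_index (F : fieldType) (m : F) r : has_nil_index (hesse_algebra m r) 3.
Proof.
split=> [|j]; first exact: hesse_pow3.
(* The cubic takes the value 1 at the first basis vector, so [e^3] is [hesse_top] and A, A^2, A^3
   are nonzero. *)
pose e := hesse_gen m r (delta_mx 0 0).
have e3 : amul e (amul e e) = hesse_top m r.
  rewrite hesse_mul3 hesse_triE !mxE /= (_ : _ + _ = 1) ?scale1r //; ring.
have nz3 : amul e (amul e e) != 0 by rewrite e3 hesse_top_neq0.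
have nz2 : amul e e != 0 by apply: contra_neq nz3 => ->; rewrite linear0r.
have nz1 : e != 0 by apply: contra_neq nz2 => ->; rewrite linear0r.
have A1 : @apowS F (hesse_algebra m r) 1 (amul e e).
  by apply: lin_span_incl; exists e, e.
have A2 : @apowS F (hesse_algebra m r) 2 (amul e (amul e e)).
  by apply: lin_span_incl; exists e, (amul e e).
case: j => [|[|[|j]]] // E.
- have : @apowS F (hesse_algebra m r) 0 e by [].
  by rewrite E => /eqP; rewrite (negPf nz1).
- by move: A1; rewrite E => /eqP; rewrite (negPf nz2).
- by move: A2; rewrite E => /eqP; rewrite (negPf nz3).
Qed.

Lemma hesse_annihilator (F : fieldType) (m : F) r :
  @annihilator F (hesse_algebra m r) = [set` <[hesse_top m r]>%VS]%classic.
Proof.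
apply/seteqP; split=> [u ann|u /vlineP[a ->] v]; last first.
  by rewrite -[RHS](hesse_mul_top v a); exact: hesse_mul_comm.
(* The pairing into the last summand is nondegenerate: testing against V^*, V and F^r kills the
   first three components of [u]. *)
have top (v : hesse_algebra m r) :
    u.1.1.1 *m v.1.1.2^T + u.1.1.2 *m v.1.1.1^T + u.1.2 *m v.1.2^T = 0
  by exact: (congr1 (fun w : hesse_space F r => w.2) (ann v)).
have u1 : u.1.1.1 = 0.
  apply: row_dot_inj => y; rewrite -[RHS](top (0, y, 0, 0)) /=.
  by rewrite !trmx0 !mulmx0 !addr0.
have u2 : u.1.1.2 = 0.
  apply: row_dot_inj => y; rewrite -[RHS](top (y, 0, 0, 0)) /=.
  by rewrite !trmx0 !mulmx0 add0r addr0.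
have u3 : u.1.2 = 0.
  apply: row_dot_inj => y; rewrite -[RHS](top (0, 0, y, 0)) /=.
  by rewrite !trmx0 !mulmx0 !add0r.
apply/vlineP; exists (u.2 0 0).
case: u {ann top} u1 u2 u3 => [[[x y] w] z] /= -> -> ->.
congr (_, _, _, _) => /=; rewrite ?scaler0 //.
by rewrite scale_scalar_mx mulr1 [LHS]mx11_scalar.
Qed.

Lemma hesse_admissible (F : fieldType) (m : F) r :
  admissible_dim_nil_index (7 + r) 3 (hesse_algebra m r).
Proof.
split; [split | exact: dim_hesse_algebra | exact: hesse_nil_index].
- exact: hesse_mul_comm.
- by exists 3%N; exact: hesse_pow3.
- exists <[hesse_top m r]>%VS; split; first exact: hesse_annihilator.
  by rewrite dim_vline hesse_top_neq0.
Qed.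

(** * From isomorphisms to equivalences of cubics *)

(** Triple products see only V-components, so [g] is the V-to-V block of [f], and [c] is the factor
    by which [f] scales [hesse_top]. *)
Lemma hesse_isomorphic_cubic (F : fieldType) (s t : F) r :
  isomorphic (hesse_algebra s r) (hesse_algebra t r) ->
  exists (g : 'M[F]_3) (c : F), c != 0 /\
    forall y, hesse_cubic (1, t) (y *m g) = c * hesse_cubic (1, s) y.
Proof.
move=> [f [bijf fM]].
have g_lin : linear (fun x : 'rV[F]_3 => (f (hesse_gen s r x)).1.1.1).
  move=> a x y /=.
  have -> : hesse_gen s r (a *: x + y) = a *: hesse_gen s r x + hesse_gen s r y.
    by congr (_, _, _, _) => /=; rewrite ?scaler0 ?addr0.
  by rewrite linearP.
pose glM := GRing.isLinear.Build _ _ _ _ _ g_lin.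
pose gL : {linear 'rV[F]_3 -> 'rV[F]_3} :=
  HB.pack (fun x : 'rV[F]_3 => (f (hesse_gen s r x)).1.1.1) glM.
have f3 x : hesse_cubic (1, s) x *: f (hesse_top s r)
   = hesse_cubic (1, t) (x *m lin1_mx gL) *: hesse_top t r.
  rewrite -linearZ !hesse_cubic_tri mul_rV_lin1.
  have /= <- := hesse_mul3 (hesse_gen s r x) (hesse_gen s r x) (hesse_gen s r x).
  by rewrite !fM hesse_mul3.
(* At [e1] the source cubic equals 1, so [f3] there computes the image of [hesse_top]. *)
pose e1 : 'rV[F]_3 := delta_mx 0 0.
pose c := hesse_cubic (1, t) (e1 *m lin1_mx gL).
have ftop : f (hesse_top s r) = c *: hesse_top t r.
  rewrite -f3 (_ : hesse_cubic _ _ = 1) ?scale1r // /hesse_cubic !mxE /=; ring.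
exists (lin1_mx gL), c; split=> [|y].
  apply: contra_neq (hesse_top_neq0 s r) => c0.
  by apply: (bij_inj bijf); rewrite ftop c0 scale0r linear0.
have /(congr1 (fun u : hesse_space F r => u.2 0 0)) := f3 y.
by rewrite ftop /= !mxE /= !mulr1 mulrC.
Qed.

(** * Uncountably many isomorphy classes *)

(** A classifying map to [nat] would inject the interval into [nat], whereas its Lebesgue measure
    [b - a] is positive. *)
Lemma uncountable_of_real_family (R : realType) (T : Type) (P : T -> Prop)
    (E : T -> T -> Prop) (h : R -> T) (a b : R) :
  a < b -> (forall s, P (h s)) -> 
  (forall s t, a < s < b -> a < t < b -> E (h s) (h t) -> s = t) ->
  ~ countably_many_classes P E.
Proof.
move=> ab Ph hE [f fP].
have fh s t : f (h s) = f (h t) -> E (h s) (h t) by case: (fP _ _ (Ph s) (Ph t)).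
have : countable `]a, b[%classic.
  apply/countable_injP; exists (f \o h) => s t.
  rewrite !inE /= !in_itv /= => sab tab /fh; exact: hE.
move=> /countable_lebesgue_measure0; rewrite lebesgue_measure_itv /= lte_fin ab.
by move=> /eqP; rewrite -EFinB eqe subr_eq0 gt_eqF.
Qed.

(** The parameter stays real for both fields: [alpha] and [beta] commute with [iota], whose
    injectivity brings the invariant identity back to [R]. *)
Lemma uncountably_many_hesse (R : realType) (F : fieldType) (iota : {rmorphism R -> F})
    (n : nat) : (7 <= n)%N -> uncountably_many_admissible F n 3.
Proof.
move=> n7.
apply: (@uncountable_of_real_family R _ _ _ (fun s => hesse_algebra (iota s) (n - 7)) 0 (1 / 10)).
- by lra.
- by move=> s; rewrite -[X in admissible_dim_nil_index X](subnKC n7); exact: hesse_admissible.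
move=> s t hs ht /hesse_isomorphic_cubic [g [c [nzc gc]]].
have nz6 : 6 != 0 :> F by rewrite -(rmorph_nat iota) fmorph_eq0 pnatr_eq0.
have nzD : 1 + 8 * iota s ^+ 3 != 0.
  rewrite -(rmorph_nat iota 8) -(rmorph1 iota) -rmorphXn -rmorphM -rmorphD fmorph_eq0.
  have /andP[s0 _] := hs; have : 0 < s ^+ 3 by rewrite exprn_gt0.
  by lra.
apply: hesse_invariant_inj => //; apply: (fmorph_inj iota).
have := hesse_equiv_invariant nz6 nzc nzD gc.
have aE u : hesse_alpha (iota u) = iota (hesse_alpha u).
  by rewrite /hesse_alpha !(rmorphM, rmorphB, rmorph1, rmorphXn, rmorph_nat).
have bE u : hesse_beta (iota u) = iota (hesse_beta u).
  by rewrite /hesse_beta !(rmorphM, rmorphB, rmorph1, rmorphXn, rmorph_nat).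
by rewrite !aE !bE -!rmorphXn -!rmorphM.
Qed.

Theorem mainTheorem12 (R : realType) (n : nat) (hn : (7 <= n)%N) :
  uncountably_many_admissible R n 3 /\
  uncountably_many_admissible (complex R) n 3.
Proof.
split; first exact: (@uncountably_many_hesse R R idfun).
exact: (@uncountably_many_hesse R _ (real_complex R)).
Qed.
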